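(* Let $n\ge1$, $s\in(0,1)$, $u\in H^s(\mathbb{R}^n)$ and $a\ge0$ with $a\in L^1_{loc}(\mathbb{R}^n)$. Assume that $$\int_{\mathbb{R}^n}\int_{\mathbb{R}^n}\frac{(u(x)-u(y))(v(x)-v(y))}{|x-y|^{n+2s}}dxdy+\int_{\mathbb{R}^n}a(x)u(x)v(x)\,dx\ge0$$ for all $v\in H^s(\mathbb{R}^n)$ with $v\ge0$ almost everywhere. Then $u>0$ almost everywhere in $\mathbb{R}^n$ or $u=0$ almost everywhere in $\mathbb{R}^n$.
   Context: Functions are real-valued. $H^s(\mathbb{R}^n)$ is the space of $u\in L^2(\mathbb{R}^n)$ with $\int_{\mathbb{R}^n}\int_{\mathbb{R}^n}\frac{(u(x)-u(y))^2}{|x-y|^{n+2s}}dxdy<\infty$. The hypothesis is understood to include that, for each such $v$, the integral $\int_{\mathbb{R}^n}a u v\,dx$ is well defined (as an element of $[-\infty,+\infty]$). *)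

(* Defs.v *)
From HB Require Import structures.
From mathcomp Require Import all_boot all_order all_algebra.
From mathcomp Require Import all_classical all_reals all_analysis.

Set Implicit Arguments.
Unset Strict Implicit.
Unset Printing Implicit Defensive.

Import Order.TTheory GRing.Theory Num.Theory.
Import numFieldNormedType.Exports.

Local Open Scope classical_set_scope.
Local Open Scope ring_scope.

(* R^n is the library's ['rV[R]_n], which already carries the usual topology.
   It is given here the sigma-algebra generated by the coordinate maps, that
   is, the Borel sigma-algebra. *)
Definition measure_rV_display : measure_display.
Proof. exact: (measure_tuple_display default_measure_display). Qed.

Section measurable_rV.
Context {R : realType} (n : nat).

Let coors : 'I_n -> 'rV[R]_n -> measurableTypeR R := fun i x => x ord0 i.

Let rV_set0 : g_sigma_preimage coors set0.
Proof. exact: sigma_algebra0. Qed.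

Let rV_setC A : g_sigma_preimage coors A -> g_sigma_preimage coors (~` A).
Proof. exact: sigma_algebraC. Qed.

Let rV_bigcup (F : _^nat) : (forall i, g_sigma_preimage coors (F i)) ->
  g_sigma_preimage coors (\bigcup_i (F i)).
Proof. exact: sigma_algebra_bigcup. Qed.

HB.instance Definition _ := @isMeasurable.Build measure_rV_display
  'rV[R]_n (g_sigma_preimage coors) rV_set0 rV_setC rV_bigcup.

End measurable_rV.

Lemma measurable_fun_rVP {R : realType} d (T : measurableType d) n
    (f : T -> 'rV[R]_n) :
  measurable_fun [set: T] f <->
  forall i, measurable_fun [set: T] (fun x => f x ord0 i : measurableTypeR R).
Proof.
pose c : 'I_n -> 'rV[R]_n -> measurableTypeR R := fun i x => x ord0 i.
apply: (@iff_trans _ (g_sigma_preimage (fun i => c i \o f) `<=` measurable)).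
  rewrite g_sigma_preimage_comp; split=> [mf A [/= C preC <-]|prefS].
    exact: mf.
  by move=> _ A mA; apply: prefS; exists A.
split=> [fS i _ A mA|mf].
- apply: fS; apply: sub_sigma_algebra => /=.
  rewrite -bigcup_seq/=; exists i => /=; first by rewrite mem_index_enum.
  by exists A.
- apply: smallest_sub; first exact: sigma_algebra_measurable.
  rewrite -bigcup_seq/=; apply: bigcup_sub => i _.
  by move=> A [B mB <-]; exact: mf.
Qed.

Lemma measurable_rV_coord {R : realType} n (i : 'I_n) :
  measurable_fun [set: 'rV[R]_n] (fun x => x ord0 i : measurableTypeR R).
Proof. by move: i; apply/measurable_fun_rVP. Qed.

Section rV_cons.
Context {R : realType} (n : nat).

Definition rV_cons (p : measurableTypeR R * 'rV[R]_n) : 'rV[R]_n.+1 :=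
  \row_i if unlift ord0 i is Some j then p.2 ord0 j else p.1.

Lemma measurable_rV_cons : measurable_fun setT rV_cons.
Proof.
apply/measurable_fun_rVP => i.
under eq_fun do rewrite mxE.
case: (unlift ord0 i) => [j|]; last exact: measurable_fst.
exact: (measurableT_comp (measurable_rV_coord j)).
Qed.

HB.instance Definition _ :=
  isMeasurableFun.Build _ _ _ _ rV_cons measurable_rV_cons.

End rV_cons.

Section lebesgue_rV_succ.
Local Open Scope ereal_scope.
Context {R : realType} (n : nat).
Variable m : {sigma_finite_measure set 'rV[R]_n -> \bar R}.

Definition lebesgue_rV_succ : set 'rV[R]_n.+1 -> \bar R :=
  pushforward (@lebesgue_measure R \x m) (@rV_cons R n).

Let lebesgue_rV_succ0 : lebesgue_rV_succ set0 = 0.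
Proof. exact: measure0. Qed.

Let lebesgue_rV_succ_ge0 A : 0 <= lebesgue_rV_succ A.
Proof. exact: measure_ge0. Qed.

Let lebesgue_rV_succ_sigma_additive : semi_sigma_additive lebesgue_rV_succ.
Proof. exact: measure_semi_sigma_additive. Qed.

HB.instance Definition _ := isMeasure.Build _ _ _ lebesgue_rV_succ
  lebesgue_rV_succ0 lebesgue_rV_succ_ge0 lebesgue_rV_succ_sigma_additive.

Let rV_uncons (x : 'rV[R]_n.+1) : measurableTypeR R * 'rV[R]_n :=
  (x ord0 ord0, \row_j x ord0 (lift ord0 j)).

Let rV_consK : cancel (@rV_cons R n) rV_uncons.
Proof.
move=> [a y]; congr pair; first by rewrite mxE unlift_none.
by apply/rowP => j; rewrite !mxE liftK.
Qed.

Let measurable_rV_uncons : measurable_fun setT rV_uncons.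
Proof.
apply/measurable_fun_pair; first exact: measurable_rV_coord.
apply/measurable_fun_rVP => j; under eq_fun do rewrite mxE.
exact: measurable_rV_coord.
Qed.

Let lebesgue_rV_succ_sigma_finite : sigma_finite setT lebesgue_rV_succ.
Proof.
have /sigma_finiteP[F [TF ndF Foo]] := sigma_finiteT (@lebesgue_measure R).
have /sigma_finiteP[G [TG ndG Goo]] := sigma_finiteT m.
exists (fun k => rV_uncons @^-1` (F k `*` G k)).
  rewrite -preimage_bigcup (_ : \bigcup_k _ = setT) ?preimage_setT//.
  rewrite -setXTT TF TG predeqE => -[x y]; split.
    by move=> [k _ []/= ? ?]; split; exists k.
  move=> [/= [k _ Fkx] [l _ Gly]]; exists (maxn k l) => //; split.
  - by move: x Fkx; exact/subsetPset/ndF/leq_maxl.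
  - by move: y Gly; exact/subsetPset/ndG/leq_maxr.
move=> k; have [mF Fkoo] := Foo k; have [mG Gkoo] := Goo k; split.
  rewrite -[X in measurable X]setTI; apply: measurable_rV_uncons => //.
  exact: measurableX.
rewrite /lebesgue_rV_succ /pushforward -comp_preimage.
rewrite (_ : _ \o _ = id) ?preimage_id; last first.
  by apply/funext => p; exact: rV_consK.
by rewrite product_measure1E// lte_mul_pinfty// ge0_fin_numE.
Qed.

HB.instance Definition _ := Measure_isSigmaFinite.Build _ _ _ lebesgue_rV_succ
  lebesgue_rV_succ_sigma_finite.

End lebesgue_rV_succ.

(* Lebesgue measure on R^n, by iterating the product with Lebesgue measure on
   R; R^0 is a single point of mass 1. *)
Fixpoint lebesgue_rV {R : realType} (n : nat) :
    {sigma_finite_measure set 'rV[R]_n -> \bar R} :=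
  if n is n'.+1 then lebesgue_rV_succ (lebesgue_rV n')
  else \d_(0 : 'rV[R]_0).

Lemma lebesgue_rV_box {R : realType} (n : nat)
    (A : 'I_n -> set (measurableTypeR R)) :
  (forall i, measurable (A i)) ->
  lebesgue_rV n [set x : 'rV[R]_n | forall i, A i (x ord0 i)] =
  (\prod_(i < n) @lebesgue_measure R (A i))%E.
Proof.
elim: n A => [|n IHn] A mA.
  rewrite big_ord0 /= diracE (_ : _ \in _ = true) ?inE//=.
  by rewrite mem_set// => -[].
rewrite big_ord_recl -IHn//= /lebesgue_rV_succ /pushforward.
rewrite -product_measure1E//; last first.
  rewrite (_ : [set x | _] = \bigcap_(i in [set: 'I_n])
    ((fun x : 'rV[R]_n => x ord0 i) @^-1` A (lift ord0 i))).
    apply: fin_bigcap_measurable => [//|i _].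
    by rewrite -[X in measurable X]setTI; exact: measurable_rV_coord.
  by apply/seteqP; split => x /= Ax i; [move=> _|]; exact: Ax.
congr product_measure1; apply/seteqP; split => -[a y] /=.
- move=> H; split; first by have := H ord0; rewrite mxE unlift_none.
  by move=> i; have := H (lift ord0 i); rewrite mxE liftK.
- move=> [Aa Ay] i; rewrite mxE; case: unliftP => [j ->|->]//; exact: Ay.
Qed.

Section fractional_sobolev.
Context {R : realType} (n : nat).
Local Notation mu := (@lebesgue_rV R n).
Implicit Types (s : R) (u v a : 'rV[R]_n -> R).

(* The library's norm on ['rV[R]_n] is the sup norm. *)
Definition euclidean_norm (x : 'rV[R]_n) : R :=
  Num.sqrt (\sum_(i < n) (x ord0 i) ^+ 2).

(* On the null diagonal the quotient takes the junk value [0]. *)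
Definition gagliardo_form s u v : \bar R :=
  (\int[(mu \x mu)%E]_p
    ((u p.1 - u p.2) * (v p.1 - v p.2) /
      euclidean_norm (p.1 - p.2) `^ (n%:R + 2 * s))%:E)%E.

Definition fractional_sobolev s : set ('rV[R]_n -> R) :=
  [set u | u \in Lfun mu 2%:E /\ (gagliardo_form s u u < +oo)%E].

Definition L1_loc : set ('rV[R]_n -> R) :=
  [set a | measurable_fun setT a /\
    forall K, compact K -> mu.-integrable K (EFin \o a)].

(* The library's integral is total: it returns [-oo] for [+oo - +oo]. *)
Definition integral_well_defined (f : 'rV[R]_n -> R) : bool :=
  (\int[mu]_x ((EFin \o f)^\+ x) +? - \int[mu]_x ((EFin \o f)^\- x))%E.

End fractional_sobolev.

(* Main.v *)
Require Import Defs.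
From HB Require Import structures.
From mathcomp Require Import all_boot all_order all_algebra.
From mathcomp Require Import all_classical all_reals all_analysis.
From mathcomp Require Import measurable_realfun lra ring.
Set Implicit Arguments.
Unset Strict Implicit.
Unset Printing Implicit Defensive.
Import Order.TTheory GRing.Theory Num.Theory.
Import numFieldNormedType.Exports.
Local Open Scope classical_set_scope.
Local Open Scope ring_scope.

(** The form is nonlocal, and this makes the alternative elementary: if u >= 0
    vanishes on a set Z of positive measure, it may be tested against functions
    supported in Z, which see every positive value of u at once.

    Nonnegativity.  Testing with the negative part v of u makes the form at
    most - [v]^2 and the potential term at most 0, so [v]^2 = 0.  A square
    integrable function of zero energy vanishes almost everywhere, because the
    measure of the whole space is infinite ([energy_le0_ae0]).  So u >= 0
    ([finite_energy_ge0]).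

    The test function.  Let phi >= 0 be a bounded cut-off of finite energy, and
    let phi_Z be phi on Z = {u = 0} and 0 elsewhere.  Formally, testing with
    phi_Z leaves
      0 <= - 2 int_Z int_(Z^c) phi(x) u(y) K(x, y) dy dx,
    so that Z meets {phi > 0} in a null set or u = 0 almost everywhere
    ([zero_set_dichotomy]).  What has to be proved is that phi_Z has finite
    energy although Z is only measurable.  The functions v_k = (phi - k u)^+
    converge pointwise to phi_Z, and testing with v_k gives
      [v_k]^2 <= [phi]^2 + int a phi^2
    uniformly in k ([energy_truncation_le]), because k u = phi - (phi - k u) and
    k u v_k <= phi^2 / 2.  Fatou's lemma then bounds the energy of phi_Z
    ([finite_energy_zero_set]).

    This argument works for the energy of any nonnegative kernel K that is
    positive off the diagonal, over a space of infinite measure that is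
    exhausted by the sets {phi > 0} ([strong_maximum_principle]).  In R^n the
    cut-offs are phi_j(x) = (j - |x_1| - ... - |x_n|)^+.  They are Lipschitz,
    bounded and supported in a box, so that a phi_j^2 is integrable; their
    energy is finite because the contributions of the dyadic shells of x - y
    decay geometrically, both towards the diagonal and towards infinity
    ([cutoff_finite_energy]). *)

(** * Integration of real-valued functions *)

Lemma le_integral_EFin d (T : measurableType d) (R : realType)
    (m : {measure set T -> \bar R}) (f g : T -> R) :
  measurable_fun setT f -> measurable_fun setT g ->
  (forall x, 0 <= f x) -> (forall x, f x <= g x) ->
  (\int[m]_x (f x)%:E <= \int[m]_x (g x)%:E)%E.
Proof.
move=> mf mg f0 fg; apply: ge0_le_integral => //.
- by move=> x _; rewrite lee_fin.
- exact/measurable_EFinP.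
- exact/measurable_EFinP.
- by move=> x _; rewrite lee_fin.
Qed.

Lemma integral_EFin_le0 d (T : measurableType d) (R : realType)
    (m : {measure set T -> \bar R}) (f : T -> R) :
  (forall x, f x <= 0) -> (\int[m]_x (f x)%:E <= 0)%E.
Proof.
move=> f0; under eq_integral do rewrite -(opprK (f _)) EFinN.
rewrite integral_ge0N => [|x _]; last by rewrite lee_fin oppr_ge0.
by rewrite oppe_le0 integral_ge0// => x _; rewrite lee_fin oppr_ge0.
Qed.

Lemma integrable_EFin_ge0 d (T : measurableType d) (R : realType)
    (m : {measure set T -> \bar R}) (f : T -> R) :
  measurable_fun setT f -> (forall x, 0 <= f x) ->
  (\int[m]_x (f x)%:E < +oo)%E -> m.-integrable setT (EFin \o f).
Proof.
move=> mf f0 foo; apply/integrableP; split; first exact/measurable_EFinP.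
by under eq_integral => x _ do rewrite /= ger0_norm//.
Qed.

Lemma Lfun2P d (T : measurableType d) (R : realType)
    (m : {measure set T -> \bar R}) (u : T -> R) :
  u \in Lfun m 2%:E <->
  measurable_fun setT u /\ (\int[m]_x (u x ^+ 2)%:E < +oo)%E.
Proof.
split=> [Lu|[mu uoo]].
  split; first by move: Lu; rewrite inE => /andP[]; rewrite inE.
  have /integrableP[_] := Lfun2_integrable_sqr Lu.
  by under eq_integral => x _ do rewrite /= ger0_norm ?sqr_ge0//.
rewrite inE; apply/andP; rewrite !inE; split => //=.
rewrite /finite_norm unlock /Lnorm; apply: poweR_lty.
rewrite (eq_integral (fun x => (u x ^+ 2)%:E))// => x _ /=.
by rewrite powR_mulrn// -normrX ger0_norm// sqr_ge0.
Qed.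

(** Passes from the vanishing of a double integral to a statement about single
    sets: the product measure of A x B is m A * m B, and it is null because the
    integrand is positive there. *)
Lemma ge0_integral_eq0_rectangle d (T : measurableType d) (R : realType)
    (m : {sigma_finite_measure set T -> \bar R}) (g : T * T -> R)
    (A B : set T) :
  measurable_fun setT g -> (forall p, 0 <= g p) ->
  (\int[m \x m]_p (g p)%:E <= 0)%E ->
  measurable A -> measurable B ->
  (forall x y, A x -> B y -> 0 < g (x, y)) ->
  m A = 0%E \/ m B = 0%E.
Proof.
move=> mg g0 ig0 mA mB AB.
have : ae_eq (m \x m)%E setT (EFin \o g) (cst 0%E).
  apply/ae_eq_integral_abs => //; first exact/measurable_EFinP.
  under eq_integral => x _ do rewrite /= ger0_norm//.
  apply/eqP; rewrite eq_le ig0/= integral_ge0// => p _.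
  by rewrite lee_fin.
move=> [N [mN N0 sub]].
have AB0 : (m \x m)%E (A `*` B) = 0%E.
  apply: (subset_measure0 _ mN _ N0); first exact: measurableX.
  move=> [x y] [/= Ax By]; apply: sub => /= /(_ I) [] gxy.
  by have := AB _ _ Ax By; rewrite gxy ltxx.
move: AB0; rewrite product_measure1E// => /eqP.
by rewrite mule_eq0 => /orP[/eqP|/eqP]; [left|right].
Qed.

Lemma measurable_set_ltr d (T : measurableType d) (R : realType)
    (f g : T -> R) :
  measurable_fun setT f -> measurable_fun setT g ->
  measurable [set x | f x < g x].
Proof.
move=> mf mg; rewrite -[X in measurable X]setTI.
by have /(_ measurableT [set true]) := measurable_fun_ltr mf mg; apply.
Qed.

Lemma measurable_set_le0_gt0 d (T : measurableType d) (R : realType)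
    (f g : T -> R) :
  measurable_fun setT f -> measurable_fun setT g ->
  measurable [set x | f x <= 0 /\ 0 < g x].
Proof.
move=> mf mg.
rewrite (_ : [set x | _] = ~` [set x | 0 < f x] `&` [set x | 0 < g x]).
  apply: measurableI; [apply: measurableC|];
    by apply: measurable_set_ltr => //; exact: measurable_cst.
apply/seteqP; split => x /= [fx gx]; split => //.
  by apply/negP; rewrite -leNgt.
by rewrite leNgt; exact/negP.
Qed.

(** Tonelli's theorem, in the form of an upper bound for the measure of a band
    around the diagonal. *)
Lemma product_measure_strip1 d (T : measurableType d) (R : realType)
    (m : {sigma_finite_measure set T -> \bar R}) (A : set (T * T)) (B : set T)
    (w : R) : measurable A -> measurable B -> 0 <= w ->
  (forall p, A p -> B p.1) -> (forall x, (m (xsection A x) <= w%:E)%E) ->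
  ((m \x m)%E A <= w%:E * m B)%E.
Proof.
move=> mA mB w0 AB Aw.
rewrite -(setIT B) -integral_indic// -ge0_integralZl//; last first.
  by apply: measurableT_comp => //; exact: measurable_indic.
apply: ge0_le_integral => //.
- exact: measurable_fun_xsection.
- by apply: measurable_funeM; apply: measurableT_comp => //; exact: measurable_indic.
move=> x _; rewrite indicE; case: (boolP (x \in B)) => [_|].
  by rewrite mule1; exact: Aw.
rewrite notin_setE => nBx; rewrite mule0 /= (_ : xsection A x = set0) ?measure0//.
apply/seteqP; split => y //=; rewrite /xsection/= inE => Axy.
by apply: nBx; exact: AB Axy.
Qed.

Lemma product_measure_strip2 d (T : measurableType d) (R : realType)
    (m : {sigma_finite_measure set T -> \bar R}) (A : set (T * T)) (B : set T)
    (w : R) : measurable A -> measurable B -> 0 <= w ->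
  (forall p, A p -> B p.2) -> (forall y, (m (ysection A y) <= w%:E)%E) ->
  ((m \x m)%E A <= w%:E * m B)%E.
Proof.
move=> mA mB w0 AB Aw.
have -> : (m \x m)%E A = (m \x^ m)%E A.
  by apply: product_measure_unique => // ? ? ? ?; exact: product_measure2E.
rewrite -(setIT B) -integral_indic// -ge0_integralZl//; last first.
  by apply: measurableT_comp => //; exact: measurable_indic.
apply: ge0_le_integral => //.
- exact: measurable_fun_ysection.
- by apply: measurable_funeM; apply: measurableT_comp => //; exact: measurable_indic.
move=> y _; rewrite indicE; case: (boolP (y \in B)) => [_|].
  by rewrite mule1; exact: Aw.
rewrite notin_setE => nBy; rewrite mule0 /= (_ : ysection A y = set0) ?measure0//.
apply/seteqP; split => x //=; rewrite /ysection/= inE => Axy.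
by apply: nBy; exact: AB Axy.
Qed.

(** A countable cover by sets of controlled measure, on each of which f is
    bounded, turns integrability into the convergence of a numerical series:
    f is dominated by the sum of the c_k times the indicators of the A_k. *)
Lemma integral_lty_cover d (T : measurableType d) (R : realType)
    (m : {measure set T -> \bar R}) (f : T -> R) (A : nat -> set T)
    (c w : nat -> R) :
  measurable_fun setT f -> (forall x, 0 <= f x) ->
  (forall k, measurable (A k)) -> (forall k, 0 <= c k) ->
  (forall k, (m (A k) <= (w k)%:E)%E) ->
  (\sum_(0 <= k <oo) (c k * w k)%:E < +oo)%E ->
  (forall x, f x = 0 \/ exists k, A k x /\ f x <= c k) ->
  (\int[m]_x (f x)%:E < +oo)%E.
Proof.
move=> mf f0 mA c0 Aw cwoo cover.
have mcA k : measurable_fun setT (fun x => (c k * \1_(A k) x)%:E).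
  by apply/measurable_EFinP; apply: measurable_funM => //; exact: measurable_indic.
have cA0 k x : (0 <= (c k * \1_(A k) x)%:E)%E by rewrite lee_fin mulr_ge0.
apply: le_lt_trans cwoo.
apply: (@le_trans _ _ (\int[m]_x \sum_(0 <= k <oo) (c k * \1_(A k) x)%:E)%E).
  apply: ge0_le_integral => //.
  - by move=> x _; rewrite lee_fin.
  - exact: measurableT_comp.
  - by apply: ge0_emeasurable_sum.
  - move=> x _; have [->|[k [Akx fxc]]] := cover x; first exact: nneseries_ge0.
    apply: (@le_trans _ _ (\sum_(0 <= i < k.+1) (c i * \1_(A i) x)%:E)%E); last first.
      exact: nneseries_lim_ge.
    rewrite big_nat_recr//= indicE mem_set// mulr1.
    apply: (@le_trans _ _ (c k)%:E); first by rewrite lee_fin.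
    by rewrite leeDr// sume_ge0.
rewrite integral_nneseries//; apply: lee_nneseries => k _.
  by move=> _; exact: integral_ge0.
under eq_integral do rewrite EFinM.
rewrite ge0_integralZl ?lee_fin//; last first.
  by apply: measurableT_comp => //; exact: measurable_indic.
by rewrite integral_indic// setIT EFinM lee_wpmul2l ?lee_fin.
Qed.

Lemma nneseries_geometric_lty (R : realType) (C x : R) :
  0 <= C -> 0 <= x -> x < 1 -> (\sum_(0 <= k <oo) (C * x ^+ k)%:E < +oo)%E.
Proof.
move=> C0 x0 x1.
have := @cvg_geometric_series R C x; rewrite ger0_norm// => /(_ x1) h.
rewrite (_ : limn _ = (C * (1 - x)^-1)%:E) ?ltry//.
apply/cvg_lim => //.
rewrite (_ : (fun n => _) = EFin \o series (geometric C x)).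
  exact: cvg_comp h _.
by apply/funext => k /=; rewrite /series/= sumEFin.
Qed.

(** * Inequalities for positive parts *)

Lemma norm_max0_le (R : realDomainType) (x : R) : `|Num.max x 0| <= `|x|.
Proof. by case: (leP x 0) => x0; rewrite ?normr0 ?normr_ge0. Qed.

Lemma norm_max0B_le (R : realFieldType) (x y : R) :
  `|Num.max x 0 - Num.max y 0| <= `|x - y|.
Proof.
case: (leP x 0) => x0; case: (leP y 0) => y0; rewrite ?subrr ?normr0 ?normr_ge0//;
  by case: (ger0P (x - y)) => ?; rewrite ler_norml; apply/andP; split; lra.
Qed.

(** Truncation does not increase the energy, in the polarised form: this is
    the pointwise inequality that lets positive parts serve as test
    functions. *)
Lemma sqr_max0B_le (R : realFieldType) (x y : R) :
  (Num.max x 0 - Num.max y 0) * (Num.max x 0 - Num.max y 0) <=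
  (x - y) * (Num.max x 0 - Num.max y 0).
Proof. by case: (leP x 0) => ?; case: (leP y 0) => ?; nra. Qed.

Lemma sqr_normD_le (R : realFieldType) (x y z C : R) :
  0 <= C -> `|x| <= C * (`|y| + `|z|) ->
  x * x <= C ^+ 2 * 2 * (y * y) + C ^+ 2 * 2 * (z * z).
Proof.
move=> C0 h.
have -> : x * x = `|x| * `|x| by rewrite -normrM ger0_norm// -expr2 sqr_ge0.
have -> : y * y = `|y| * `|y| by rewrite -normrM ger0_norm// -expr2 sqr_ge0.
have -> : z * z = `|z| * `|z| by rewrite -normrM ger0_norm// -expr2 sqr_ge0.
apply: (@le_trans _ _ ((C * (`|y| + `|z|)) * (C * (`|y| + `|z|)))).
  exact: ler_pM.
rewrite -subr_ge0.
have -> : C ^+ 2 * 2 * (`|y| * `|y|) + C ^+ 2 * 2 * (`|z| * `|z|) -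
   C * (`|y| + `|z|) * (C * (`|y| + `|z|)) = C ^+ 2 * (`|y| - `|z|) ^+ 2.
  by ring.
by rewrite mulr_ge0// sqr_ge0.
Qed.

(** * The energy of a nonnegative kernel *)

Section energy.
Context d (T : measurableType d) (R : realType).
Variables (m : {sigma_finite_measure set T -> \bar R}) (K : T * T -> R).
Hypotheses (mK : measurable_fun setT K) (K_ge0 : forall p, 0 <= K p).
Implicit Types u v w : T -> R.

Definition energy u v : \bar R :=
  (\int[(m \x m)%E]_p ((u p.1 - u p.2) * (v p.1 - v p.2) * K p)%:E)%E.

(** For the kernel |x - y|^-(n + 2 s) and Lebesgue measure, this is
    [fractional_sobolev] up to conversion. *)
Definition finite_energy : set (T -> R) :=
  [set u | u \in Lfun m 2%:E /\ (energy u u < +oo)%E].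

Lemma measurable_incr u : measurable_fun setT u ->
  measurable_fun setT (fun p : T * T => u p.1 - u p.2).
Proof.
move=> mu; apply: measurable_funB.
- by apply: (measurableT_comp mu); exact: measurable_fst.
- by apply: (measurableT_comp mu); exact: measurable_snd.
Qed.

Lemma measurable_energy u v :
  measurable_fun setT u -> measurable_fun setT v ->
  measurable_fun setT
    (fun p : T * T => (u p.1 - u p.2) * (v p.1 - v p.2) * K p).
Proof.
move=> mu mv; apply: measurable_funM => //.
by apply: measurable_funM; exact: measurable_incr.
Qed.

Lemma finite_energy_measurable u : finite_energy u -> measurable_fun setT u.
Proof. by case=> /Lfun2P[]. Qed.

Lemma energy_diag_ge0 u p : 0 <= (u p.1 - u p.2) * (u p.1 - u p.2) * K p.
Proof. by rewrite mulr_ge0// -expr2 sqr_ge0. Qed.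

Lemma integrable_energy_diag u : finite_energy u ->
  (m \x m)%E.-integrable setT
    (fun p => ((u p.1 - u p.2) * (u p.1 - u p.2) * K p)%:E).
Proof.
move=> Hu; have mu := finite_energy_measurable Hu; case: Hu => _ Eu.
apply: (@integrable_EFin_ge0 _ _ _ (m \x m)%E) => //.
- exact: measurable_energy.
- exact: energy_diag_ge0.
Qed.

Lemma integrable_energy u v : finite_energy u -> finite_energy v ->
  (m \x m)%E.-integrable setT
    (fun p => ((u p.1 - u p.2) * (v p.1 - v p.2) * K p)%:E).
Proof.
move=> Hu Hv.
have mu := finite_energy_measurable Hu; have mv := finite_energy_measurable Hv.
have := @integrableD _ _ _ (m \x m)%E _ measurableT _ _
  (integrable_energy_diag Hu) (integrable_energy_diag Hv).
apply: le_integrable => //.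
  by apply/measurable_EFinP; exact: (measurable_energy mu mv).
move=> p _ /=; rewrite lee_fin.
rewrite [leRHS]ger0_norm ?addr_ge0 ?energy_diag_ge0//.
rewrite normrM (ger0_norm (K_ge0 p)) -mulrDl ler_wpM2r// ler_norml.
move: (u p.1 - u p.2) (v p.1 - v p.2) => x y.
have := sqr_ge0 (x + y); have := sqr_ge0 (x - y).
have := sqr_ge0 x; have := sqr_ge0 y.
rewrite !expr2 => ? ? ? ?; apply/andP; split; nra.
Qed.

Lemma energy_fin_num u : finite_energy u -> energy u u \is a fin_num.
Proof.
by move=> Hu; apply: integrable_fin_num => //; exact: integrable_energy_diag.
Qed.

(** The one closure property of the energy space that is needed: it covers
    linear combinations, contractions and truncations. *)
Lemma finite_energy_dominated (C : R) u w v : 0 <= C ->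
  finite_energy u -> finite_energy w -> measurable_fun setT v ->
  (forall x, `|v x| <= C * (`|u x| + `|w x|)) ->
  (forall x y, `|v x - v y| <= C * (`|u x - u y| + `|w x - w y|)) ->
  finite_energy v.
Proof.
move=> C0 Hu Hw mv vuw dvuw.
have mu := finite_energy_measurable Hu; have mw := finite_energy_measurable Hw.
split.
  apply/Lfun2P; split => //.
  have iu := Lfun2_integrable_sqr (proj1 Hu).
  have iw := Lfun2_integrable_sqr (proj1 Hw).
  have := @integrableD _ _ _ m _ measurableT _ _
    (integrableZl measurableT (C ^+ 2 * 2) iu)
    (integrableZl measurableT (C ^+ 2 * 2) iw).
  move=> /(@integrable_lty _ _ _ m _ measurableT); apply: le_lt_trans.
  apply: (@le_integral_EFin _ _ _ m (fun x => v x ^+ 2)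
    (fun x => C ^+ 2 * 2 * (u x ^+ 2) + C ^+ 2 * 2 * (w x ^+ 2))).
  - exact: measurable_funX.
  - by apply: measurable_funD; apply: measurable_funM => //;
      exact: measurable_funX.
  - by move=> x; exact: sqr_ge0.
  - by move=> x; rewrite (expr2 (v x)) (expr2 (u x)) (expr2 (w x)) sqr_normD_le.
have := @integrableD _ _ _ (m \x m)%E _ measurableT _ _
  (integrableZl measurableT (C ^+ 2 * 2) (integrable_energy_diag Hu))
  (integrableZl measurableT (C ^+ 2 * 2) (integrable_energy_diag Hw)).
move=> /(@integrable_lty _ _ _ (m \x m)%E _ measurableT); apply: le_lt_trans.
apply: (@le_integral_EFin _ _ _ (m \x m)%E _
   (fun p => C ^+ 2 * 2 * ((u p.1 - u p.2) * (u p.1 - u p.2) * K p) +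
             C ^+ 2 * 2 * ((w p.1 - w p.2) * (w p.1 - w p.2) * K p))).
- exact: measurable_energy.
- by apply: measurable_funD; apply: measurable_funM => //;
    exact: measurable_energy.
- exact: energy_diag_ge0.
- move=> p; have := ler_wpM2r (K_ge0 p) (sqr_normD_le C0 (dvuw p.1 p.2)).
  by move=> /le_trans; apply; rewrite mulrDl !mulrA.
Qed.

Hypothesis K_gt0 : forall p, p.1 <> p.2 -> 0 < K p.

Lemma markov_sqr (u : T -> R) (t : R) : 0 < t -> u \in Lfun m 2%:E ->
  (m [set x | (t < `|u x|)%R] < +oo)%E.
Proof.
move=> t0 /Lfun2P[mu uoo].
have mA : measurable [set x | t < `|u x|].
  apply: measurable_set_ltr; first exact: measurable_cst.
  exact: measurableT_comp.
have : ((t ^+ 2)%:E * m [set x | (t < `|u x|)%R] <= \int[m]_x (u x ^+ 2)%:E)%E.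
  rewrite -(setIT [set x | _]) -integral_indic// -ge0_integralZl//; last first.
  - by rewrite lee_fin sqr_ge0.
  - by apply: measurableT_comp => //; exact: measurable_indic.
  apply: (@le_integral_EFin _ _ _ m
    (fun x => t ^+ 2 * \1_([set x | t < `|u x|]) x)).
  - by apply: measurable_funM => //; exact: measurable_indic.
  - exact: measurable_funX.
  - by move=> x; rewrite mulr_ge0// sqr_ge0.
  - move=> x; rewrite indicE; case: (boolP (x \in _)) => [|_].
      rewrite inE/= mulr1 -(real_normK (num_real (u x))) => h.
      by rewrite ler_sqr ?nnegrE ?normr_ge0 ?(ltW t0)// ltW.
    by rewrite mulr0 sqr_ge0.
move=> /le_lt_trans => /(_ _ uoo) tA; rewrite ltey; apply/eqP => Aoo.
by move: tA; rewrite Aoo gt0_muley// lte_fin exprn_gt0.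
Qed.

Hypothesis mT : m setT = +oo%E.

(** Zero energy forces {|u| > t} x {|u| <= t} to be null for every t > 0.  The
    first factor has finite measure by Chebyshev's inequality, so the second has
    infinite measure and the first must be the null one. *)
Lemma energy_le0_ae0 u : u \in Lfun m 2%:E -> (energy u u <= 0)%E ->
  {ae m, forall x, u x = 0}.
Proof.
move=> Lu Eu; have [mu _] := (Lfun2P _ _).1 Lu.
have mnu : measurable_fun setT (fun x => `|u x|) by exact: measurableT_comp.
have null (t : R) : 0 < t -> m.-negligible [set x | t < `|u x|].
  move=> t0.
  have mA : measurable [set x | t < `|u x|].
    by apply: measurable_set_ltr => //; exact: measurable_cst.
  have Aoo := markov_sqr t0 Lu.
  apply/negligibleP => //.
  have [//|B0] : m [set x | (t < `|u x|)%R] = 0%E \/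
                 m (~` [set x | (t < `|u x|)%R]) = 0%E.
    apply: (ge0_integral_eq0_rectangle (measurable_energy mu mu)
      (energy_diag_ge0 _) Eu) => //; first exact: measurableC.
    move=> x y /= tx /negP; rewrite -leNgt => ty.
    have uxy : u x != u y by apply: contraTneq tx => ->; rewrite -leNgt.
    rewrite mulr_gt0 ?K_gt0//=; last by move=> xy; rewrite xy eqxx in uxy.
    by rewrite -expr2 exprn_even_gt0//= subr_eq0.
  have : m setT = 0%E + m [set x | (t < `|u x|)%R].
    rewrite -[in X in _ = X + _]B0 -measureU//; last by rewrite setICl.
    by rewrite setUCl.
    exact: measurableC.
  by rewrite mT add0e => h; rewrite -h in Aoo.
have : m.-negligible (\bigcup_k [set x | (k.+1%:R^-1 : R) < `|u x|]).
  by apply: negligible_bigcup => k; apply: null; rewrite invr_gt0.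
apply: negligibleS => x /= /eqP ux0.
have : 0 < `|u x| by rewrite normr_gt0.
move=> /ltr_add_invr[k]; rewrite add0r => kx.
by exists k.
Qed.

Definition supersolution (a u : T -> R) := forall v, finite_energy v ->
  {ae m, forall x, 0 <= v x} ->
  (0 <= energy u v + \int[m]_x (a x * u x * v x)%:E)%E.

Lemma finite_energy_neg_part u : finite_energy u ->
  finite_energy (fun x => Num.max (- u x) 0).
Proof.
move=> Hu; have mu := finite_energy_measurable Hu.
apply: (@finite_energy_dominated 1 u u) => //.
- apply: measurable_maxr; last exact: measurable_cst.
  exact: measurableT_comp.
- move=> x; rewrite mul1r (le_trans (norm_max0_le _))// normrN.
  by rewrite lerDl normr_ge0.
- move=> x y; rewrite mul1r (le_trans (norm_max0B_le _ _))//.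
  by rewrite -opprD normrN lerDl normr_ge0.
Qed.

Lemma finite_energy_ge0 (a u : T -> R) : finite_energy u ->
  (forall x, 0 <= a x) -> supersolution a u -> {ae m, forall x, 0 <= u x}.
Proof.
move=> Hu a0 su; pose v x := Num.max (- u x) 0.
have v0 x : 0 <= v x by rewrite le_max lexx orbT.
have Hv : finite_energy v by exact: finite_energy_neg_part.
have Evv : (energy v v <= 0)%E.
  have Euv : (energy u v <= - energy v v)%E.
    rewrite /energy -integral_ge0N; last first.
      by move=> p _; rewrite lee_fin energy_diag_ge0.
    apply: le_integral => //; first exact: integrable_energy.
      exact/integrableN/integrable_energy_diag.
    move=> p _; rewrite lee_fin -mulNr ler_wpM2r//.
    have := sqr_max0B_le (- u p.1) (- u p.2).
    rewrite -!/(v _); move: (v p.1 - v p.2) => dv ?; lra.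
  have Iauv : (\int[m]_x (a x * u x * v x)%:E <= 0)%E.
    apply: integral_EFin_le0 => x; rewrite -mulrA mulr_ge0_le0// /v.
    by case: (leP (- u x) 0) => ?; nra.
  have := su _ Hv (aeW m v0) => /le_trans => /(_ _ (leeD Euv Iauv)).
  by rewrite adde0 oppe_ge0.
have := energy_le0_ae0 (proj1 Hv) Evv.
apply: filterS => x; rewrite /v; case: (leP (- u x) 0) => h.
  by move=> _; lra.
by move=> h'; lra.
Qed.

Section zero_set.
Variables (a u phi : T -> R) (M : R).
Hypotheses (ma : measurable_fun setT a) (a0 : forall x, 0 <= a x).
Hypotheses (Hu : finite_energy u) (u0 : forall x, 0 <= u x).
Hypotheses (Hphi : finite_energy phi) (phi0 : forall x, 0 <= phi x).
Hypothesis (phiM : forall x, phi x <= M).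
Hypothesis (iphi : (\int[m]_x (a x * phi x ^+ 2)%:E < +oo)%E).
Hypothesis (su : supersolution a u).

Let v (k : R) x := Num.max (phi x - k * u x) 0.

Let v_ge0 k x : 0 <= v k x.
Proof. by rewrite le_max lexx orbT. Qed.

Let Hv k : 0 <= k -> finite_energy (v k).
Proof.
move=> k0; have mu := finite_energy_measurable Hu.
have mphi := finite_energy_measurable Hphi.
apply: (@finite_energy_dominated (1 + k) phi u) => //; first lra.
- apply: measurable_maxr; last exact: measurable_cst.
  by apply: measurable_funB => //; apply: measurable_funM.
- move=> x; apply: (le_trans (norm_max0_le _)).
  apply: (le_trans (ler_normB _ _)); rewrite normrM (ger0_norm k0).
  by have := normr_ge0 (phi x); have := normr_ge0 (u x); nra.
- move=> x y; apply: (le_trans (norm_max0B_le _ _)).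
  have -> : phi x - k * u x - (phi y - k * u y) =
            (phi x - phi y) - k * (u x - u y) by ring.
  apply: (le_trans (ler_normB _ _)); rewrite normrM (ger0_norm k0).
  by have := normr_ge0 (phi x - phi y); have := normr_ge0 (u x - u y); nra.
Qed.

(** The bound that does not depend on k.  With w = phi - k u and v = w^+, one
    has k du dv = (dphi - dw) dv <= (dphi^2 - dv^2) / 2, since dv^2 <= dw dv and
    2 dphi dv <= dphi^2 + dv^2; likewise k u v = (phi - w) w^+ <= phi^2 / 2.
    Dividing by k and using that u is a supersolution gives the claim. *)
Lemma energy_truncation_le k : 0 < k ->
  (energy (v k) (v k) <= energy phi phi + \int[m]_x (a x * phi x ^+ 2)%:E)%E.
Proof.
move=> k0; have mu := finite_energy_measurable Hu.
have mphi := finite_energy_measurable Hphi.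
have Hvk := Hv (ltW k0); have mv := finite_energy_measurable Hvk.
(* Half of 1 / k: the Young inequality halves the two squares. *)
pose c := (2 * k)^-1.
have c0 : 0 < c by rewrite invr_gt0 mulr_gt0.
have ck : c * k = 2^-1 by rewrite /c; field; rewrite gt_eqF.
have Euv : (energy u (v k) <= c%:E * (energy phi phi - energy (v k) (v k)))%E.
  rewrite /energy -integralB//; [|exact: integrable_energy_diag..].
  rewrite -integralZl//; last by apply: integrableB => //; exact: integrable_energy_diag.
  apply: le_integral => //; first exact: integrable_energy.
    by apply: integrableZl => //; apply: integrableB => //; exact: integrable_energy_diag.
  move=> p _; rewrite -EFinB -EFinM lee_fin -mulrBl [leRHS]mulrA ler_wpM2r//.
  rewrite -(ler_pM2l k0) [leRHS]mulrA (mulrC k c) ck.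
  have := sqr_max0B_le (phi p.1 - k * u p.1) (phi p.2 - k * u p.2).
  rewrite -!/(v _ _); move: (v k p.1 - v k p.2) => dv.
  have := sqr_ge0 (phi p.1 - phi p.2 - dv).
  move: (u p.1) (u p.2) (phi p.1) (phi p.2) => u1 u2 f1 f2; rewrite expr2 => h1 h2.
  lra.
have Iauv : (\int[m]_x (a x * u x * v k x)%:E <=
             c%:E * \int[m]_x (a x * phi x ^+ 2)%:E)%E.
  rewrite -ge0_integralZl//; last 3 first.
  - apply/measurable_EFinP; apply: measurable_funM => //.
    exact: measurable_funX.
  - by move=> x _; rewrite lee_fin mulr_ge0// sqr_ge0.
  - by rewrite lee_fin ltW.
  apply: (@le_integral_EFin _ _ _ m _ (fun x => c * (a x * phi x ^+ 2))).
  - by do 2 (apply: measurable_funM => //).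
  - apply: measurable_funM => //; apply: measurable_funM => //.
    exact: measurable_funX.
  - by move=> x; rewrite !mulr_ge0.
  - move=> x; rewrite mulrCA -mulrA ler_wpM2l// -(ler_pM2l k0).
    rewrite [leRHS]mulrA (mulrC k c) ck expr2 /v.
    have := sqr_ge0 (phi x - k * u x); have := sqr_ge0 (k * u x).
    by rewrite !expr2; case: (leP (phi x - k * u x) 0) => ? ? ?; nra.
have := su Hvk (aeW m (@v_ge0 k)) => /le_trans => /(_ _ (leeD Euv Iauv)).
have Iphi0 : (0 <= \int[m]_x (a x * phi x ^+ 2)%:E)%E.
  by apply: integral_ge0 => x _; rewrite lee_fin mulr_ge0// sqr_ge0.
have := iphi; rewrite -ge0_fin_numE//.
move: (energy_fin_num Hvk) (energy_fin_num Hphi).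
move: (energy (v k) (v k)) (energy phi phi) (\int[m]_x _)%E.
move=> [r| |] [r'| |] [r''| |]//= _ _ _.
rewrite -EFinB -!EFinM -!EFinD !lee_fin -mulrDr pmulr_rge0//.
by move=> ?; lra.
Qed.

Let w x := if u x <= 0 then phi x else 0.

Let mw : measurable_fun setT w.
Proof.
have mu := finite_energy_measurable Hu.
apply: measurable_fun_ifT => //; last exact: finite_energy_measurable.
by apply: measurable_fun_ler => //; exact: measurable_cst.
Qed.

Let truncation_eventually x : \forall k \near \oo, v k.+1%:R x = w x.
Proof.
rewrite /v /w; case: (leP (u x) 0) => ux.
  have {ux}-> : u x = 0 by apply/eqP; rewrite eq_le ux u0.
  by apply: nearW => k; rewrite mulr0 subr0; apply/max_idPl.
near=> k; apply/max_idPr; rewrite subr_le0 (le_trans (phiM x))//.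
rewrite -ler_pdivrMr//; apply: (@le_trans _ _ k%:R); last by rewrite ler_nat.
by near: k; exact: nbhs_infty_ger.
Unshelve. all: by end_near. Qed.

(** Membership of a function cut off by an arbitrary measurable set in the
    energy space: the approximations are eventually constant at each point, so
    Fatou's lemma transfers their uniform energy bound. *)
Lemma finite_energy_zero_set : finite_energy w.
Proof.
have mphi := finite_energy_measurable Hphi.
have mv k : measurable_fun setT (v k.+1%:R).
  by apply: finite_energy_measurable; apply: Hv.
split.
  apply/Lfun2P; split => //; have /Lfun2P[_] := proj1 Hphi.
  apply: le_lt_trans; apply: le_integral_EFin.
  - exact: measurable_funX.
  - exact: measurable_funX.
  - by move=> x; exact: sqr_ge0.
  - by move=> x; rewrite /w; case: ifP => // _; rewrite expr0n sqr_ge0.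
pose B := (energy phi phi + \int[m]_x (a x * phi x ^+ 2)%:E)%E.
apply: (@le_lt_trans _ _ B); last first.
  by rewrite lte_add_pinfty// -ge0_fin_numE ?energy_fin_num//
     integral_ge0// => p _; rewrite lee_fin energy_diag_ge0.
pose F k (p : T * T) :=
  ((v k.+1%:R p.1 - v k.+1%:R p.2) * (v k.+1%:R p.1 - v k.+1%:R p.2) * K p)%:E.
have -> : energy w w = (\int[(m \x m)%E]_p limn_einf (F^~ p))%E.
  apply: eq_integral => p _; apply/esym.
  have /cvg_limn_einf_sup[-> //] : F^~ p @ \oo -->
      ((w p.1 - w p.2) * (w p.1 - w p.2) * K p)%:E.
  apply: cvg_near_cst; near=> k.
  have -> : F k p = ((w p.1 - w p.2) * (w p.1 - w p.2) * K p)%:E; last by [].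
  have h1 : v k.+1%:R p.1 = w p.1 by near: k; exact: truncation_eventually.
  have h2 : v k.+1%:R p.2 = w p.2 by near: k; exact: truncation_eventually.
  by rewrite /F h1 h2.
apply: (le_trans (fatou (m \x m)%E measurableT _ _)).
- by move=> k; apply/measurable_EFinP; exact: measurable_energy.
- by move=> k p _; rewrite lee_fin; exact: energy_diag_ge0.
rewrite limn_einf_lim; apply: lime_le; first exact: is_cvg_einfs.
apply: nearW => k; apply: (@le_trans _ _ (\int[(m \x m)%E]_p F k p)%E).
  by apply: ereal_inf_lbound; exists k => /=.
by apply: energy_truncation_le.
Unshelve. all: by end_near. Qed.

(** Since u w = 0, the potential term drops out and du dw = - u(x) w(y) -
    u(y) w(x) <= 0.  The energy of the pair is therefore both nonnegative and
    nonpositive, and its integrand is negative on {u = 0, phi > 0} x {u > 0}. *)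
Lemma zero_set_dichotomy :
  m [set x | u x <= 0 /\ 0 < phi x] = 0%E \/ m [set x | 0 < u x] = 0%E.
Proof.
have mu := finite_energy_measurable Hu.
have mphi := finite_energy_measurable Hphi.
have w0 x : 0 <= w x by rewrite /w; case: ifP.
have uw0 x : u x * w x = 0.
  rewrite /w; case: (leP (u x) 0) => [ux|]; last by rewrite mulr0.
  by have /eqP -> : u x == 0; rewrite ?mul0r// eq_le ux u0.
have Hw := finite_energy_zero_set.
have g0 p : (u p.1 - u p.2) * (w p.1 - w p.2) * K p <= 0.
  rewrite mulr_le0_ge0//; have := uw0 p.1; have := uw0 p.2.
  have : 0 <= u p.1 * w p.2 by rewrite mulr_ge0.
  have : 0 <= u p.2 * w p.1 by rewrite mulr_ge0.
  by move=> ? ? ? ?; nra.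
have mg := measurable_energy mu mw.
have : (0 <= energy u w)%E.
  have := su Hw (aeW m w0).
  rewrite [X in (_ + X)%E](_ : _ = 0%E) ?adde0//.
  by under eq_integral do rewrite -mulrA uw0 mulr0; rewrite integral0.
pose g p := - ((u p.1 - u p.2) * (w p.1 - w p.2) * K p).
have -> : energy u w = (- \int[(m \x m)%E]_p (g p)%:E)%E.
  rewrite -integral_ge0N => [|p _]; last by rewrite lee_fin oppr_ge0.
  by apply: eq_integral => p _; rewrite -EFinN /g opprK.
rewrite oppe_ge0 => ig.
apply: (ge0_integral_eq0_rectangle _ _ ig).
- exact: measurableT_comp.
- by move=> p; rewrite oppr_ge0.
- exact: measurable_set_le0_gt0.
- by apply: measurable_set_ltr => //; exact: measurable_cst.
- move=> x y /= [ux phx] uy.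
  have ux0 : u x = 0 by apply/eqP; rewrite eq_le ux u0.
  have wy0 : w y = 0 by rewrite /w leNgt uy.
  have wx : w x = phi x by rewrite /w ux.
  rewrite /g/= ux0 wy0 wx sub0r subr0 -!mulNr opprK mulr_gt0//.
    by rewrite mulr_gt0.
  by apply: K_gt0 => /= xy; move: uy; rewrite /= -xy ux0 ltxx.
Qed.

End zero_set.

Lemma ae_product (P : T -> Prop) : {ae m, forall x, P x} ->
  {ae (m \x m)%E, forall p, P p.1 /\ P p.2}.
Proof.
move=> [N [mN N0 PN]].
have : (m \x m)%E.-negligible ((N `*` setT) `|` (setT `*` N)).
  have mNT : measurable (N `*` [set: T]) by exact: measurableX.
  have mTN : measurable ([set: T] `*` N) by exact: measurableX.
  apply: negligibleU; apply/negligibleP => //=; rewrite product_measure1E//.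
    by rewrite [X in (X * _)%E]N0 mul0e.
  by rewrite [X in (_ * X)%E]N0 mule0.
apply: negligibleS => -[x y] /= /not_andP[] nP; [left|right]; split => //; exact: PN.
Qed.

Lemma supersolution_ae_eq (a a' u u' : T -> R) :
  measurable_fun setT a -> measurable_fun setT a' ->
  measurable_fun setT u -> measurable_fun setT u' ->
  {ae m, forall x, a x = a' x} -> {ae m, forall x, u x = u' x} ->
  supersolution a u -> supersolution a' u'.
Proof.
move=> ma ma' mu mu' aa' uu' su v Hv v0.
have mv := finite_energy_measurable Hv.
have := su v Hv v0; congr (_ <= _ + _)%E.
- apply: ae_eq_integral => //.
  + by apply/measurable_EFinP; exact: measurable_energy.
  + by apply/measurable_EFinP; exact: measurable_energy.
  + by apply: filterS (ae_product uu') => p [-> ->] _.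
- apply: ae_eq_integral => //.
  + by apply/measurable_EFinP; do 2 (apply: measurable_funM => //).
  + by apply/measurable_EFinP; do 2 (apply: measurable_funM => //).
  + by apply: filterS2 aa' uu' => x -> ->.
Qed.

Lemma negligible_ae (A : set T) : m.-negligible A -> {ae m, forall x, ~ A x}.
Proof. by apply: negligibleS => x /= /contrapT. Qed.

(** Replacing u and a by their positive parts changes them on null sets only and
    reduces the statement to pointwise nonnegative data.  If {u > 0} is not
    null, the dichotomy makes {u = 0} null inside each {phi_j > 0}, hence null. *)
Theorem strong_maximum_principle (a u : T -> R) (phi : nat -> T -> R)
    (M : nat -> R) :
  measurable_fun setT a -> {ae m, forall x, 0 <= a x} ->
  finite_energy u -> supersolution a u ->
  (forall j, finite_energy (phi j)) -> (forall j x, 0 <= phi j x <= M j) ->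
  (forall j, m.-integrable setT (fun x => (a x * phi j x ^+ 2)%:E)) ->
  (forall x, exists j, 0 < phi j x) ->
  {ae m, forall x, 0 < u x} \/ {ae m, forall x, u x = 0}.
Proof.
move=> ma a0 Hu su Hphi phiM iphi cover.
have mu := finite_energy_measurable Hu.
pose b x := Num.max (a x) 0.
have mb : measurable_fun setT b by apply: measurable_maxr => //; exact: measurable_cst.
have b0 x : 0 <= b x by rewrite le_max lexx orbT.
have ab : {ae m, forall x, a x = b x}.
  by apply: filterS a0 => x ax; apply/esym/max_idPl.
have sbu : supersolution b u by apply: supersolution_ae_eq su => //; exact: aeW.
have u0 := finite_energy_ge0 Hu b0 sbu.
pose u' x := Num.max (u x) 0.
have mu' : measurable_fun setT u' by apply: measurable_maxr => //; exact: measurable_cst.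
have u'0 x : 0 <= u' x by rewrite le_max lexx orbT.
have uu' : {ae m, forall x, u x = u' x}.
  by apply: filterS u0 => x ux; apply/esym/max_idPl.
have sbu' : supersolution b u' by apply: supersolution_ae_eq sbu => //; exact: aeW.
have Hu' : finite_energy u'.
  apply: (@finite_energy_dominated 1 u u) => //.
  - move=> x; rewrite mul1r (le_trans (norm_max0_le _))//.
    by rewrite lerDl normr_ge0.
  - move=> x y; rewrite mul1r (le_trans (norm_max0B_le _ _))//.
    by rewrite lerDl normr_ge0.
have ib j : (\int[m]_x (b x * phi j x ^+ 2)%:E < +oo)%E.
  rewrite (_ : (\int[m]_x _)%E = (\int[m]_x (a x * phi j x ^+ 2)%:E)%E).
    by apply: integrable_lty => //; exact: iphi.
  have mphi := finite_energy_measurable (Hphi j).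
  apply: ae_eq_integral => //.
  + by apply/measurable_EFinP; apply: measurable_funM => //; apply: measurable_funX.
  + by apply/measurable_EFinP; apply: measurable_funM => //; apply: measurable_funX.
  + by apply: filterS ab => x ->.
have dich j := zero_set_dichotomy mb b0 Hu' u'0 (Hphi j)
  (fun x => proj1 (andP (phiM j x))) (fun x => proj2 (andP (phiM j x)))
  (ib j) sbu'.
have [P0|P0] := eqVneq (m [set x | (0 < u' x)%R]) 0%E.
  right; have nP : {ae m, forall x, ~ 0 < u' x}.
    apply: (negligible_ae (A := [set x | 0 < u' x])); apply/negligibleP => //.
    by apply: measurable_set_ltr => //; exact: measurable_cst.
  apply: filterS2 uu' nP => x -> /negP; rewrite -leNgt => u'x.
  by apply/eqP; rewrite eq_le u'x u'0.
left; have nZ : {ae m, forall x, ~ exists j, u' x <= 0 /\ 0 < phi j x}.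
  apply: (negligibleS (A := \bigcup_j [set x | u' x <= 0 /\ 0 < phi j x])).
    by move=> x /= /contrapT[j]; exists j.
  apply: negligible_bigcup => j; apply/negligibleP.
    by apply: measurable_set_le0_gt0 => //; exact: finite_energy_measurable.
  by have [//|P0'] := dich j; rewrite P0' eqxx in P0.
apply: filterS2 uu' nZ => x -> nZ; rewrite ltNge; apply/negP => u'x.
by apply: nZ; have [j phj] := cover x; exists j.
Qed.

End energy.

(** * Dyadic shells *)

Lemma powRX (R : realType) (x a : R) k : 0 <= x ->
  (x ^+ k) `^ a = (x `^ a) ^+ k.
Proof.
move=> x0; rewrite -(powR_mulrn k x0) -(powR_mulrn k (powR_ge0 x a)).
by rewrite -!powRrM mulrC.
Qed.

Lemma exprn_div_powR (R : realType) (r q : R) k : 0 < r ->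
  r ^+ k / r `^ q = r `^ (k%:R - q).
Proof.
move=> r0; rewrite powRD; last by rewrite (gt_eqF r0) implybT.
by rewrite powRN powR_mulrn// ltW.
Qed.

Lemma powR_lt1 (R : realType) (x a : R) :
  0 <= x -> x < 1 -> 0 < a -> x `^ a < 1.
Proof.
move=> x0 x1 a0; have <- : 1 `^ a = 1 :> R by rewrite powR1.
by rewrite gt0_ltr_powR ?nnegrE.
Qed.

(** On a shell whose radii have ratio 2, the kernel can be evaluated at the inner
    radius and volumes at the outer one, losing only a factor independent of
    k. *)
Lemma dyadic_shell_near (R : realType) (t : R) : 0 < t -> t <= 1 ->
  exists k, t <= 2^-1 ^+ k /\ 2^-1 ^+ k / 2 < t.
Proof.
move=> t0 t1.
have ex : exists k, 2^-1 ^+ k / 2 < t.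
  exists (Num.bound t^-1).
  have h : t^-1 < (Num.bound t^-1)%:R by apply: archi_boundP; rewrite invr_ge0 ltW.
  rewrite -exprSr exprVn -[ltRHS]invrK ltf_pV2 ?posrE ?exprn_gt0 ?invr_gt0//.
  by rewrite (lt_trans h)// -natrX ltr_nat (ltn_trans _ (ltn_expl _ _)).
case: (ex_minnP ex) => -[|k] tk kmin; first by exists 0%N; rewrite expr0 in tk *.
exists k.+1; split => //; rewrite leNgt; apply/negP => h.
by have := kmin k; rewrite -exprSr h => /(_ isT); rewrite ltnn.
Qed.

Lemma dyadic_shell_far (R : realType) (t : R) : 1 < t ->
  exists k, t <= 2 ^+ k.+1 /\ 2 ^+ k < t.
Proof.
move=> t1.
have ex : exists k, t <= 2 ^+ k.+1.
  exists (Num.bound t).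
  have h : t < (Num.bound t)%:R by apply: archi_boundP; lra.
  by rewrite ltW// (lt_trans h)// -natrX ltr_nat (ltn_trans _ (ltn_expl _ _)).
case: (ex_minnP ex) => -[|k] tk kmin; first by exists 0%N; rewrite expr0 in tk *.
exists k.+1; split => //; rewrite ltNge; apply/negP => h.
by have := kmin k h; rewrite ltnn.
Qed.

(** * Boxes and the fractional kernel in R^n *)

Section euclidean_space.
Context (R : realType) (n : nat).
Local Notation mu := (@lebesgue_rV R n).
Local Notation E := 'rV[R]_n.

(** Balls of the sup norm, whose Lebesgue measure is a product of lengths.  The
    Euclidean ball of radius r is contained in the box of radius r, which is all
    that upper bounds require. *)
Definition box (x : E) (r : R) : set E :=
  [set y | forall i, `|x ord0 i - y ord0 i| <= r].

Lemma measurable_incr_coord (i : 'I_n) :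
  measurable_fun setT (fun p : E * E => p.1 ord0 i - p.2 ord0 i).
Proof.
apply: measurable_funB.
- by apply: (measurableT_comp (measurable_rV_coord i)); exact: measurable_fst.
- by apply: (measurableT_comp (measurable_rV_coord i)); exact: measurable_snd.
Qed.

Lemma measurable_band (r : R) : measurable [set p : E * E | box p.1 r p.2].
Proof.
rewrite (_ : [set p | _] = \bigcap_(i in [set: 'I_n])
    ~` [set p : E * E | r < `|p.1 ord0 i - p.2 ord0 i|]).
  apply: fin_bigcap_measurable => // i _; apply: measurableC.
  apply: measurable_set_ltr; first exact: measurable_cst.
  by apply: measurableT_comp => //; exact: measurable_incr_coord.
apply/seteqP; split => p /= h i; first by move=> _; apply/negP; rewrite -leNgt.
by rewrite leNgt; apply/negP; exact: h.
Qed.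

Lemma lebesgue_rV_boxE (x : E) (r : R) : 0 <= r ->
  mu (box x r) = ((2 * r) ^+ n)%:E.
Proof.
move=> r0.
rewrite (_ : box x r =
    [set y : E | forall i, `[x ord0 i - r, x ord0 i + r]%classic (y ord0 i)]).
  rewrite (@lebesgue_rV_box R n
    (fun i => `[x ord0 i - r, x ord0 i + r]%classic)) => [|i]; last first.
    exact: measurable_itv.
  rewrite (eq_bigr (fun=> (2 * r)%:E)).
    by rewrite prodEFin prodr_const card_ord.
  move=> i _; rewrite lebesgue_measure_itv/= lte_fin.
  case: ltP => h; first by rewrite -EFinB; congr (_%:E); ring.
  by congr (_%:E); lra.
by apply/seteqP; split => y h i; have := h i; rewrite /= in_itv/= ler_distlC.
Qed.

Lemma measurable_box (x : E) (r : R) : measurable (box x r).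
Proof.
have := measurable_xsection x (measurable_band r).
rewrite (_ : xsection _ _ = box x r)//.
by apply/seteqP; split => y; rewrite /xsection /= inE.
Qed.

Lemma compact_box (x : E) (r : R) : compact (box x r).
Proof.
rewrite (_ : box x r =
    [set y : E | forall i, `[x ord0 i - r, x ord0 i + r]%classic (y ord0 i)]).
  apply: (@rV_compact R n (fun i => `[x ord0 i - r, x ord0 i + r]%classic)) => i.
  exact: segment_compact.
by apply/seteqP; split => y h i; have := h i; rewrite /= in_itv/= ler_distlC.
Qed.

Lemma lebesgue_rVT : (0 < n)%N -> mu setT = +oo%E.
Proof.
move=> n0; have := @lebesgue_rV_box R n (fun=> setT) (fun=> measurableT).
rewrite (_ : [set x | _] = setT); last by apply/seteqP; split.
move=> ->; rewrite (eq_bigr (fun=> +oo%E)); last first.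
  by move=> i _; rewrite -set_itvNyy lebesgue_measure_itv/=.
case: n n0 => // k _; elim: k => [|k IH]; first by rewrite big_ord_recl big_ord0 mule1.
by rewrite big_ord_recl IH mulyy.
Qed.

Lemma norm_coord_le_euclidean (z : E) (i : 'I_n) :
  `|z ord0 i| <= euclidean_norm z.
Proof.
rewrite -sqrtr_sqr ler_wsqrtr// (bigD1 i)//= lerDl sumr_ge0// => j _.
exact: sqr_ge0.
Qed.

Lemma euclidean_norm_gt0 (z : E) : z <> 0 -> 0 < euclidean_norm z.
Proof.
move=> /eqP z0; rewrite lt_neqAle sqrtr_ge0 andbT; apply: contra_neq z0 => z0.
apply/rowP => i; rewrite mxE; apply/normr0_eq0/eqP.
by rewrite eq_le normr_ge0 andbT z0 norm_coord_le_euclidean.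
Qed.

Lemma measurable_euclidean_incr :
  measurable_fun setT (fun p : E * E => euclidean_norm (p.1 - p.2)).
Proof.
apply: (@measurableT_comp _ _ _ _ _ _ (@Num.sqrt R)).
  by apply: continuous_measurable_fun; exact: sqrt_continuous.
apply: measurable_sum => i; apply: measurable_funX.
rewrite (_ : (fun _ => _) = (fun p : E * E => p.1 ord0 i - p.2 ord0 i)).
  exact: measurable_incr_coord.
by apply/funext => p; rewrite !mxE.
Qed.

Definition gagliardo_kernel (s : R) (p : E * E) : R :=
  (euclidean_norm (p.1 - p.2) `^ (n%:R + 2 * s))^-1.

Lemma measurable_gagliardo_kernel s : measurable_fun setT (gagliardo_kernel s).
Proof.
rewrite (_ : gagliardo_kernel s =
   (fun p => euclidean_norm (p.1 - p.2) `^ (- (n%:R + 2 * s)))).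
  apply: (@measurableT_comp _ _ _ _ _ _ (fun x : R => x `^ (- (n%:R + 2 * s)))).
    exact: measurable_powR.
  exact: measurable_euclidean_incr.
by apply/funext => p; rewrite powRN.
Qed.

Lemma gagliardo_kernel_ge0 s p : 0 <= gagliardo_kernel s p.
Proof. by rewrite invr_ge0 powR_ge0. Qed.

Lemma gagliardo_kernel_gt0 s p : p.1 <> p.2 -> 0 < gagliardo_kernel s p.
Proof.
move=> p12; rewrite invr_gt0 powR_gt0// euclidean_norm_gt0//.
by move=> /eqP; rewrite subr_eq0 => /eqP.
Qed.

(** * Cut-off functions *)

(** The sum of the |x_i| makes the cut-off a function of the coordinates that is
    visibly measurable; any Lipschitz function of compact support would do. *)
Definition cutoff (j : R) (x : E) := Num.max (j - \sum_(i < n) `|x ord0 i|) 0.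

Lemma measurable_cutoff j : measurable_fun setT (cutoff j).
Proof.
apply: measurable_maxr; last exact: measurable_cst.
apply: measurable_funB => //; apply: measurable_sum => i.
by apply: measurableT_comp => //; exact: measurable_rV_coord.
Qed.

Lemma cutoff_ge0 j x : 0 <= cutoff j x.
Proof. by rewrite le_max lexx orbT. Qed.

Lemma cutoff_le j x : 0 <= j -> cutoff j x <= j.
Proof. by move=> j0; rewrite ge_max j0 andbT gerBl sumr_ge0. Qed.

Lemma cutoff_eq0 j x : ~ box 0 j x -> cutoff j x = 0.
Proof.
move=> /existsNP[i /negP]; rewrite -ltNge mxE sub0r normrN => ji.
apply/max_idPr; rewrite subr_le0 (le_trans (ltW ji))// (bigD1 i)//=.
by rewrite lerDl sumr_ge0.
Qed.

Lemma cutoff_lipschitz j x y :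
  `|cutoff j x - cutoff j y| <= n%:R * euclidean_norm (x - y).
Proof.
apply: (le_trans (norm_max0B_le _ _)).
have -> : j - \sum_(i < n) `|x ord0 i| - (j - \sum_(i < n) `|y ord0 i|) =
    \sum_(i < n) (`|y ord0 i| - `|x ord0 i|) by rewrite sumrB; ring.
rewrite mulr_natl -[X in _ *+ X]card_ord -sumr_const.
apply: (le_trans (ler_norm_sum _ _ _)); apply: ler_sum => i _.
apply: le_trans (norm_coord_le_euclidean _ i).
by rewrite !mxE (le_trans (ler_dist_dist _ _))// distrC.
Qed.

(** By Tonelli's theorem, the pairs with one point in the fixed box and the other
    within r_k of it have measure of order r_k^n.  The covering bound then
    reduces the integral to the series of the c_k r_k^n, here a geometric
    one. *)
Lemma integral_lty_shells (j : R) (g : E * E -> R) (r c : nat -> R) (C x : R) :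
  0 <= j -> measurable_fun setT g -> (forall p, 0 <= g p) ->
  (forall k, 0 <= r k) -> (forall k, 0 <= c k) ->
  0 <= C -> 0 <= x -> x < 1 -> (forall k, c k * r k ^+ n = C * x ^+ k) ->
  (forall p, g p = 0 \/ exists k, [/\ box 0 j p.1 \/ box 0 j p.2,
     box p.1 (r k) p.2 & g p <= c k]) ->
  (\int[(mu \x mu)%E]_p (g p)%:E < +oo)%E.
Proof.
move=> j0 mg g0 r0 c0 C0 x0 x1 cr cover.
pose W := (2 * j) ^+ n + (2 * j) ^+ n.
have W0 : 0 <= W by rewrite addr_ge0// exprn_ge0// mulr_ge0.
have mB := measurable_box 0 j.
have mB1 : measurable [set p : E * E | box 0 j p.1].
  by rewrite -[X in measurable X]setTI; exact: measurable_fst.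
have mB2 : measurable [set p : E * E | box 0 j p.2].
  by rewrite -[X in measurable X]setTI; exact: measurable_snd.
pose A1 k := [set p : E * E | box 0 j p.1] `&` [set p | box p.1 (r k) p.2].
pose A2 k := [set p : E * E | box 0 j p.2] `&` [set p | box p.1 (r k) p.2].
have mA1 k : measurable (A1 k).
  by apply: measurableI => //; exact: measurable_band.
have mA2 k : measurable (A2 k).
  by apply: measurableI => //; exact: measurable_band.
have rn0 k : 0 <= (2 * r k) ^+ n by rewrite exprn_ge0// mulr_ge0.
apply: (@integral_lty_cover _ _ _ (mu \x mu)%E g (fun k => A1 k `|` A2 k) c
  (fun k => (2 * r k) ^+ n * W)) => //.
- by move=> k; exact: measurableU.
- move=> k; apply: (@le_trans _ _ ((mu \x mu)%E (A1 k) + (mu \x mu)%E (A2 k))%E).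
    exact: measureU2.
  rewrite mulrDr EFinD !EFinM -(lebesgue_rV_boxE 0 j0); apply: leeD.
  + apply: product_measure_strip1 => //; first by move=> p [].
    move=> y; rewrite -(lebesgue_rV_boxE y (r0 k)) le_measure ?inE//.
    * exact: measurable_xsection.
    * exact: measurable_box.
    * by move=> z; rewrite /xsection /= inE => -[].
  + apply: product_measure_strip2 => //; first by move=> p [].
    move=> y; rewrite -(lebesgue_rV_boxE y (r0 k)) le_measure ?inE//.
    * exact: measurable_ysection.
    * exact: measurable_box.
    * move=> z; rewrite /ysection /= inE => -[_ /= h] i.
      by rewrite distrC; exact: h.
- apply: le_lt_trans (nneseries_geometric_lty (C := C * (2 ^+ n * W)) _ x0 x1);
    last by rewrite mulr_ge0// mulr_ge0// exprn_ge0.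
  apply: lee_nneseries => [k _ _|k _]; first by rewrite lee_fin !mulr_ge0.
  rewrite lee_fin le_eqVlt; apply/orP; left; apply/eqP.
  by rewrite mulrAC -cr exprMn; ring.
- move=> p; have [->|[k [B12 Q gc]]] := cover p; first by left.
  by right; exists k; split => //; case: B12 => B12; [left|right].
Qed.

Lemma gagliardo_kernel_le s t p : 0 <= s -> 0 < t ->
  t < euclidean_norm (p.1 - p.2) ->
  gagliardo_kernel s p <= (t `^ (n%:R + 2 * s))^-1.
Proof.
move=> s0 t0 tp; have r0 := lt_trans t0 tp.
rewrite lef_pV2 ?posrE ?powR_gt0//.
have q0 : 0 <= n%:R + 2 * s by rewrite addr_ge0// mulr_ge0.
by apply: ge0_ler_powR; rewrite ?nnegrE ?sqrtr_ge0 ?(ltW t0) ?(ltW tp).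
Qed.

(** Near the diagonal the increment is at most n |x - y|, and the shell of
    radius r = 2^-k contributes a multiple of r^2 r^-(n + 2 s) r^n =
    r^(2 - 2 s), summable as s < 1.  Far from it the increment is at most j, and the shell of radius
    r = 2^k contributes a multiple of r^-(n + 2 s) r^n = r^(- 2 s), summable as
    s > 0. *)
Lemma cutoff_finite_energy s (j : R) : 0 < s < 1 -> 0 <= j ->
  finite_energy mu (gagliardo_kernel s) (cutoff j).
Proof.
move=> /andP[s0 s1] j0; have mc := measurable_cutoff j.
split.
  apply/Lfun2P; split => //.
  apply: (@le_lt_trans _ _ (\int[mu]_x (j ^+ 2 * \1_(box 0 j) x)%:E)%E).
    apply: le_integral_EFin => //.
    - exact: measurable_funX.
    - by apply: measurable_funM => //; apply: measurable_indic; exact: measurable_box.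
    - by move=> x; exact: sqr_ge0.
    move=> x; rewrite indicE; case: (boolP (x \in _)) => [_|].
      by rewrite mulr1 lerXn2r ?nnegrE ?cutoff_ge0// cutoff_le.
    by rewrite notin_setE => /cutoff_eq0 ->; rewrite mulr0 expr0n.
  under eq_integral do rewrite EFinM.
  rewrite ge0_integralZl ?lee_fin ?sqr_ge0//; last first.
    by apply: measurableT_comp => //; apply: measurable_indic; exact: measurable_box.
  rewrite integral_indic ?setIT//; last exact: measurable_box.
  by rewrite [X in (_ * X)%E]lebesgue_rV_boxE// -EFinM ltry.
pose q := n%:R + 2 * s.
pose f (p : E * E) := (cutoff j p.1 - cutoff j p.2) *
  (cutoff j p.1 - cutoff j p.2) * gagliardo_kernel s p.
have f0 p : 0 <= f p by apply: energy_diag_ge0; exact: gagliardo_kernel_ge0.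
have mf : measurable_fun setT f.
  by apply: measurable_energy => //; exact: measurable_gagliardo_kernel.
have f_out p : ~ (box 0 j p.1 \/ box 0 j p.2) -> f p = 0.
  by move=> /not_orP[] /cutoff_eq0 h1 /cutoff_eq0 h2; rewrite /f h1 h2 subrr !mul0r.
have f_diag p : p.1 = p.2 -> f p = 0 by move=> h; rewrite /f h subrr !mul0r.
have in_box (p : E * E) r : euclidean_norm (p.1 - p.2) <= r -> box p.1 r p.2.
  move=> pr i; apply: le_trans pr.
  by have := norm_coord_le_euclidean (p.1 - p.2) i; rewrite !mxE.
have f_le p b t : (cutoff j p.1 - cutoff j p.2) ^+ 2 <= b ->
    0 < t -> t < euclidean_norm (p.1 - p.2) -> f p <= b * (t `^ q)^-1.
  move=> b0 t0 tp; rewrite ler_pM//.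
  - by rewrite -expr2 sqr_ge0.
  - exact: gagliardo_kernel_ge0.
  - by apply: gagliardo_kernel_le => //; exact: ltW.
(* The part of f near the diagonal, and the part far from it. *)
pose fn p := if euclidean_norm (p.1 - p.2) <= 1 then f p else 0.
pose ff p := if euclidean_norm (p.1 - p.2) <= 1 then 0 else f p.
have mle : measurable_fun setT
    (fun p : E * E => euclidean_norm (p.1 - p.2) <= 1).
  by apply: measurable_fun_ler => //; exact: measurable_euclidean_incr.
have fn0 p : 0 <= fn p by rewrite /fn; case: ifP.
have ff0 p : 0 <= ff p by rewrite /ff; case: ifP.
have mfn : measurable_fun setT fn by exact: measurable_fun_ifT.
have mff : measurable_fun setT ff by exact: measurable_fun_ifT.
apply: (@le_lt_trans _ _
    (\int[(mu \x mu)%E]_p (fn p)%:E + \int[(mu \x mu)%E]_p (ff p)%:E)%E).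
  rewrite -ge0_integralD//; last 4 first.
  - by move=> p _; rewrite lee_fin.
  - exact/measurable_EFinP.
  - by move=> p _; rewrite lee_fin.
  - exact/measurable_EFinP.
  rewrite le_eqVlt; apply/orP; left; apply/eqP.
  apply: eq_integral => p _; rewrite -EFinD /fn /ff.
  by case: ifP; rewrite ?addr0 ?add0r.
apply: lte_add_pinfty.
  apply: (@integral_lty_shells j fn (fun k => 2^-1 ^+ k)
    (fun k => (n%:R ^+ 2 * (2^-1 ^+ k) ^+ 2) * ((2^-1 ^+ k / 2) `^ q)^-1)
    (n%:R ^+ 2 * (2^-1 `^ q)^-1) (2^-1 `^ (2 - 2 * s))) => //.
  - by apply: powR_lt1 => //; [rewrite invf_lt1 ?ltr1n | lra].
  - move=> k; rewrite -powRX ?invr_ge0//.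
    have r0 : 0 < 2^-1 ^+ k :> R by rewrite exprn_gt0.
    move: (2^-1 ^+ k) r0 => r r0.
    have -> : 2 - 2 * s = (2 + n)%:R - q by rewrite natrD /q; ring.
    rewrite -exprn_div_powR// powRM ?invr_ge0 ?(ltW r0)// invfM exprD.
    by move: (r `^ q)^-1 (2^-1 `^ q)^-1 => ? ?; ring.
  - move=> p; rewrite /fn; case: ifPn => [p1|]; last by left.
    have [|B12] := pselect (box 0 j p.1 \/ box 0 j p.2); last first.
      by left; exact: f_out.
    have [p12|p12] := eqVneq p.1 p.2; first by left; exact: f_diag.
    have p0 : 0 < euclidean_norm (p.1 - p.2).
      by apply: euclidean_norm_gt0; apply/eqP; rewrite subr_eq0.
    have [k [pr rp]] := dyadic_shell_near p0 p1.
    right; exists k; split => //; first exact: in_box.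
    apply: f_le rp; last by rewrite divr_gt0// exprn_gt0.
    rewrite -exprMn -(real_normK (num_real (cutoff j p.1 - _))).
    rewrite lerXn2r ?nnegrE// ?mulr_ge0//.
    by apply: (le_trans (cutoff_lipschitz j p.1 p.2)); rewrite ler_wpM2l.
apply: (@integral_lty_shells j ff (fun k => 2 ^+ k.+1)
    (fun k => j ^+ 2 * ((2 ^+ k) `^ q)^-1)
    (j ^+ 2 * 2 ^+ n) (2 `^ (- (2 * s)))) => //.
- by move=> k; rewrite divr_ge0 ?sqr_ge0// powR_ge0.
- by rewrite mulr_ge0 ?sqr_ge0.
- have -> : 2 `^ (- (2 * s)) = 2^-1 `^ (2 * s).
    by rewrite -(powR_inv1 (ler0n R 2)) -powRrM mulN1r.
  by apply: powR_lt1 => //; [rewrite invf_lt1 ?ltr1n | lra].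
- move=> k; rewrite -powRX//.
  have r0 : 0 < 2 ^+ k :> R by rewrite exprn_gt0.
  rewrite [2 ^+ k.+1]exprS exprMn.
  move: (2 ^+ k) r0 => r r0.
  have -> : - (2 * s) = n%:R - q by rewrite /q; ring.
  rewrite -exprn_div_powR//.
  by move: (r `^ q)^-1 => ?; ring.
- move=> p; rewrite /ff; case: ifPn => [|]; first by left.
  rewrite -ltNge => p1.
  have [B12|B12] := pselect (box 0 j p.1 \/ box 0 j p.2); last first.
    by left; exact: f_out.
  have [k [pr rp]] := dyadic_shell_far p1.
  right; exists k; split => //; first exact: in_box.
  apply: f_le rp; last by rewrite exprn_gt0.
  have := cutoff_ge0 j p.1; have := cutoff_ge0 j p.2.
  have := cutoff_le p.1 j0; have := cutoff_le p.2 j0.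
  by move=> ? ? ? ?; rewrite expr2; nra.
Qed.

Lemma cutoff_weight_integrable (a : E -> R) (j : R) : 0 <= j -> L1_loc a ->
  mu.-integrable setT (fun x => (a x * cutoff j x ^+ 2)%:E).
Proof.
move=> j0 [ma /(_ _ (compact_box (x := 0) (r := j))) ia].
have := integrableZl (measurable_box 0 j) (j ^+ 2) ia.
move=> /(integrable_mkcond _ (measurable_box 0 j)).1.
apply: le_integrable => //.
  apply/measurable_EFinP; apply: measurable_funM => //.
  by apply: measurable_funX; exact: measurable_cutoff.
move=> x _; rewrite patchE; case: ifPn => [_|].
  rewrite /= lee_fin (normrM (a x)) (normrM (j ^+ 2)) mulrC ler_wpM2r//.
  rewrite (ger0_norm (sqr_ge0 _)) (ger0_norm (sqr_ge0 j)).
  by rewrite lerXn2r ?nnegrE ?cutoff_ge0 ?cutoff_le.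
by rewrite notin_setE => /cutoff_eq0 ->; rewrite expr0n mulr0.
Qed.

Lemma cutoff_exhaustion (x : E) : exists j : nat, 0 < cutoff j%:R x.
Proof.
exists (Num.bound (\sum_(i < n) `|x ord0 i|)).
by rewrite lt_max subr_gt0 archi_boundP// sumr_ge0.
Qed.

End euclidean_space.

Theorem theorem4p4 (R : realType) (n : nat) (s : R) (u a : 'rV[R]_n -> R)
  (hn : (1 <= n)%N) (hs : 0 < s < 1)
  (hu : fractional_sobolev s u)
  (ha0 : {ae lebesgue_rV n, forall x, 0 <= a x})
  (ha : L1_loc a)
  (hsuper : forall v : 'rV[R]_n -> R, fractional_sobolev s v ->
     {ae lebesgue_rV n, forall x, 0 <= v x} ->
     integral_well_defined (fun x => a x * u x * v x) /\
     (0 <= gagliardo_form s u v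
           + \int[lebesgue_rV n]_x (a x * u x * v x)%:E)%E) :
  {ae lebesgue_rV n, forall x, 0 < u x} \/
  {ae lebesgue_rV n, forall x, u x = 0}.
Proof.
apply: (strong_maximum_principle (@measurable_gagliardo_kernel R n s)
  (@gagliardo_kernel_ge0 R n s) (@gagliardo_kernel_gt0 R n s) (lebesgue_rVT R hn)
  (a := a) (phi := fun j x => cutoff j%:R x) (M := fun j => j%:R)) => //.
- by case: ha.
- by move=> v Hv v0; have [] := hsuper v Hv v0.
- by move=> j; exact: cutoff_finite_energy.
- by move=> j x; rewrite cutoff_ge0 cutoff_le.
- by move=> j; exact: cutoff_weight_integrable.
- exact: cutoff_exhaustion.
Qed.
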